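(* Let $p$ be a positive integer and let $m_0 = m_0(p)$ be the smallest positive integer for which $$\min_{m \geq p+2}\{\widetilde{F}_v(m|_p; m-1) - m\} = \widetilde{F}_v(m_0|_p; m_0-1) - m_0.$$ Then: (a) $\widetilde{F}_v(m|_p; m-1) = \widetilde{F}_v(m_0|_p; m_0-1) + m - m_0$ for all $m \geq m_0$; (b) if $m_0 > p+2$ and $G$ is an extremal graph in $\widetilde{\mathcal{H}}(m_0|_p; m_0-1)$ (i.e. $G \in \widetilde{\mathcal{H}}(m_0|_p; m_0-1)$ and $|V(G)| = \widetilde{F}_v(m_0|_p; m_0-1)$), then $G \overset{v}{\rightarrow} (2, m_0-2)$; (c) $m_0 < \widetilde{F}_v((p+2)|_p; p+1) - p$.
   Context: All graphs are finite, simple and undirected; $\omega(G)$ denotes the clique number of $G$. For positive integers $a_1,\dots,a_s$, write $G \overset{v}{\rightarrow} (a_1,\dots,a_s)$ if for every coloring of the vertices of $G$ in $s$ colors there is an $i\in\{1,\dots,s\}$ such that $G$ contains an $a_i$-clique all of whose vertices have color $i$. For positive integers $m,p$, write $G \overset{v}{\rightarrow} m|_p$ if $G \overset{v}{\rightarrow} (a_1,\dots,a_s)$ holds for every choice of positive integers $a_1,\dots,a_s$ ($s$ not fixed) with $\sum_{i=1}^s (a_i-1)+1 = m$ and $\max\{a_1,\dots,a_s\}\le p$. Let $\widetilde{\mathcal{H}}(m|_p; q) = \{G : G \overset{v}{\rightarrow} m|_p \text{ and } \omega(G) < q\}$ and $\widetilde{F}_v(m|_p; q) = \min\{|V(G)|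 : G \in \widetilde{\mathcal{H}}(m|_p; q)\}$. (The number $\widetilde{F}_v(m|_p; m-1)$ exists exactly when $m \ge p+2$.) *)

(* Defs.v *)
From mathcomp Require Import all_boot.
From mathcomp Require Import boolp.

Set Implicit Arguments.
Unset Strict Implicit.
Unset Printing Implicit Defensive.

Definition simple_graph (T : finType) (e : rel T) : Prop :=
  symmetric e /\ irreflexive e.

Definition is_clique (T : finType) (e : rel T) (Q : {set T}) : Prop :=
  forall x y, x \in Q -> y \in Q -> x != y -> e x y.

Definition clique_lt (T : finType) (e : rel T) (q : nat) : Prop :=
  forall Q : {set T}, is_clique e Q -> #|Q| < q.

Definition varrows (T : finType) (e : rel T) (a : seq nat) : Prop :=
  forall f : T -> nat, (forall x, f x < size a) ->
    exists2 i, i < size a &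
      exists Q : {set T}, [/\ is_clique e Q, #|Q| = nth 0 a i &
                             forall x, x \in Q -> f x = i].

Definition varrows_mp (T : finType) (e : rel T) (m p : nat) : Prop :=
  forall a : seq nat, all (fun x => 0 < x) a ->
    sumn (map predn a) + 1 = m -> all (fun x => x <= p) a ->
    varrows e a.

Definition inH (T : finType) (e : rel T) (m p q : nat) : Prop :=
  simple_graph e /\ varrows_mp e m p /\ clique_lt e q.

Definition Hsize (m p q n : nat) : Prop :=
  exists e : rel 'I_n, inH e m p q.

Lemma Hsize_ex_bool (m p q : nat) :
  (exists n, Hsize m p q n) -> exists n, (fun n => `[< Hsize m p q n >]) n.
Proof. by case=> n Hn; exists n; apply/asboolP. Qed.

(* F~_v(m|_p; q) : the minimum number of vertices of a graph in H~(m|_p; q)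
   (defined as 0 when H~(m|_p; q) is empty; never used in that case). *)
Definition Fv (m p q : nat) : nat :=
  match pselect (exists n, Hsize m p q n) with
  | left H => ex_minn (Hsize_ex_bool H)
  | right _ => 0
  end.

(* Main.v *)
Require Import Defs.
From mathcomp Require Import all_boot.
From mathcomp Require Import boolp zify.

(** Write F(m) for F~_v(m|_p; m-1). Coning over a graph gives F(m+1) <= F(m) + 1,
    which together with the minimality of m0 yields (a). If an extremal graph for
    m0 > p+2 did not arrow (2, m0-2), deleting a nonempty independent set whose
    complement has no (m0-2)-clique would produce a graph in H~((m0-1)|_p; m0-2)
    with fewer than F(m0) vertices, against the choice of m0; this is (b).

    For (c), let omega(G) <= q and G -> (2, q). Then no vertex lies in all
    q-cliques, and an exchange argument shows that a q-clique satisfies Hall's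
    condition for non-adjacency. The resulting matching of q non-adjacent pairs
    colours G properly with |V(G)| - q colours. When m0 > p+2, this applies to an
    extremal graph with q = m0-2, whose chromatic number is at least m0, so that
    F(m0) >= 2 m0 - 2. When m0 = p+2, it applies with q = p after removing two
    non-adjacent vertices.

    The numbers F(m) are finite for p >= 1 by Folkman's theorem on vertex
    colourings, proved by a double induction in the style of Zykov. For p = 1
    the arrowing condition is vacuous for m > 1, so F(m) = 0, the minimum in the
    definition of m0 does not exist, and there is nothing to prove. *)

Set Implicit Arguments.
Unset Strict Implicit.
Unset Printing Implicit Defensive.

(** * Cliques and arrowing in induced subgraphs *)

Lemma subset_of_card (T : finType) (A : {set T}) k :
  k <= #|A| -> exists2 B : {set T}, B \subset A & #|B| = k.
Proof.
move=> kA; exists [set x in take k (enum A)].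
  by apply/subsetP => x; rewrite inE => /mem_take; rewrite mem_enum.
rewrite cardsE (card_uniqP _) ?take_uniq ?enum_uniq // size_take -cardE.
by case: ltngtP kA.
Qed.

Lemma is_cliqueS (T : finType) (e : rel T) (P Q : {set T}) :
  P \subset Q -> is_clique e Q -> is_clique e P.
Proof. by move=> /subsetP PQ cQ x y /PQ ? /PQ ?; apply: cQ. Qed.

Lemma is_clique1 (T : finType) (e : rel T) x : is_clique e [set x].
Proof. by move=> y z /set1P -> /set1P ->; rewrite eqxx. Qed.

Lemma is_cliqueU1 (T : finType) (e : rel T) x (Q : {set T}) :
  symmetric e -> is_clique e Q -> (forall y, y \in Q -> e x y) ->
  is_clique e (x |: Q).
Proof.
move=> es cQ exQ y z /setU1P[->|yQ] /setU1P[->|zQ] yz.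
- by rewrite eqxx in yz.
- exact: exQ.
- by rewrite es; apply: exQ.
- exact: cQ.
Qed.

Lemma is_clique_imset (S T : finType) (e : rel S) (e' : rel T) (f : S -> T) Q :
  (forall x y, e x y -> e' (f x) (f y)) -> is_clique e Q ->
  is_clique e' (f @: Q).
Proof.
move=> fe cQ _ _ /imsetP[x xQ ->] /imsetP[y yQ ->] fxy.
by apply/fe/cQ => //; apply: contraNneq fxy => ->.
Qed.

Lemma relpre_simple (S T : finType) (e : rel T) (f : S -> T) :
  simple_graph e -> simple_graph (relpre f e).
Proof. by case=> es ei; split=> [x y|x] /=; [apply: es | apply: ei]. Qed.

Lemma relpre_clique_lt (S T : finType) (e : rel T) (f : S -> T) q :
  injective f -> clique_lt e q -> clique_lt (relpre f e) q.
Proof.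
move=> fI eq Q cQ; rewrite -(card_imset _ fI).
by apply: eq; apply: is_clique_imset cQ.
Qed.

Lemma relpre_clique (S T : finType) (e : rel T) (f : S -> T) (Q : {set T}) :
  injective f -> is_clique e Q -> is_clique (relpre f e) (f @^-1: Q).
Proof.
move=> fI cQ x y; rewrite !inE => xQ yQ xy; apply: cQ => //.
by apply: contraNneq xy => /fI ->.
Qed.

Lemma card_preim_codom (S T : finType) (f : S -> T) (Q : {set T}) :
  injective f -> (forall y, y \in Q -> y \in codom f) -> #|f @^-1: Q| = #|Q|.
Proof.
move=> fI fQ; rewrite -(card_imset _ fI); apply: eq_card => y.
apply/imsetP/idP => [[x + ->]|yQ]; first by rewrite inE.
by have /codomP[x yE] := fQ y yQ; exists x; rewrite // inE -yE.
Qed.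

Lemma relpre_varrows_bij (S T : finType) (e : rel T) (f : S -> T) a :
  bijective f -> varrows e a -> varrows (relpre f e) a.
Proof.
move=> bf ea h ha; have fI := bij_inj bf; case: (bf) => g fK gK.
have [x|i ia [Q [cQ Qa hQ]]] := ea (h \o g); first exact: ha.
exists i => //; exists (f @^-1: Q); split.
- exact: relpre_clique.
- rewrite card_preim_codom // => y _; by rewrite -(gK y) codom_f.
- by move=> x; rewrite inE => /hQ /=; rewrite fK.
Qed.

(** A colouring of [S] extends to [T] by shifting its colours up by one and giving colour 0 to all
    vertices outside the image of [f]. These are independent, so colour 0 holds no 2-clique and the
    clique obtained lies in the image. *)
Lemma relpre_varrows_behead (S T : finType) (e : rel T) (f : S -> T) a :
  injective f -> (forall x y, x \notin codom f -> y \notin codom f -> ~~ e x y) ->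
  varrows e (2 :: a) -> varrows (relpre f e) a.
Proof.
move=> fI ind ea h ha.
pose h' y := if [pick x | f x == y] is Some x then (h x).+1 else 0.
have h'f x : h' (f x) = (h x).+1.
  by rewrite /h'; case: pickP => [z /eqP/fI -> //|/(_ x)]; rewrite eqxx.
have h'0 y : h' y = 0 -> y \notin codom f.
  move=> hy; apply/negP => /codomP[x yE]; by move: hy; rewrite yE h'f.
have h'S y i : h' y = i.+1 -> y \in codom f.
  by rewrite /h'; case: pickP => // x /eqP <- _; apply: codom_f.
have h'a y : h' y < size (2 :: a).
  by rewrite /h'; case: pickP => //= x _; rewrite ltnS.
have [i ia [Q [cQ Qa hQ]]] := ea h' h'a.
case: i => [|i] in ia Qa hQ *.
  have /cards2P[x [y [xy QE]]] : #|Q| == 2 by rewrite Qa.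
  have xQ : x \in Q by rewrite QE !inE eqxx.
  have yQ : y \in Q by rewrite QE !inE eqxx orbT.
  by have /negP[] := ind _ _ (h'0 _ (hQ _ xQ)) (h'0 _ (hQ _ yQ)); apply: cQ.
exists i => //; exists (f @^-1: Q); split.
- exact: relpre_clique.
- by rewrite card_preim_codom // => y /hQ /h'S.
- by move=> x; rewrite inE => /hQ; rewrite h'f => -[].
Qed.

Lemma Hsize_card (T : finType) (e : rel T) m p q :
  inH e m p q -> Hsize m p q #|T|.
Proof.
case=> se [ae ce]; exists (relpre enum_val e); split; last split.
- exact: relpre_simple.
- move=> a a0 am ap; apply: relpre_varrows_bij; last exact: ae.
  exact: enum_val_bij.
- exact/relpre_clique_lt/ce/enum_val_inj.
Qed.

Lemma Fv_le (T : finType) (e : rel T) m p q : inH e m p q -> Fv m p q <= #|T|.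
Proof.
move=> /Hsize_card He; rewrite /Fv; case: pselect => // H.
by case: ex_minnP => n _; apply; apply/asboolP.
Qed.

Lemma Fv_witness (T : finType) (e : rel T) m p q :
  inH e m p q -> exists e' : rel 'I_(Fv m p q), inH e' m p q.
Proof.
move=> /Hsize_card He; rewrite /Fv; case: pselect => [H|[]]; last by exists #|T|.
by case: ex_minnP => n /asboolP [e' He'] _; exists e'.
Qed.

(** * Cones *)

Definition cone (T : finType) (e : rel T) : rel (option T) := fun x y =>
  match x, y with
  | Some x, Some y => e x y
  | None, None => false
  | _, _ => true
  end.

Lemma cone_simple (T : finType) (e : rel T) :
  simple_graph e -> simple_graph (cone e).
Proof. by case=> es ei; split=> [[x|] [y|]|[x|]] //=. Qed.

Lemma cone_clique_lt (T : finType) (e : rel T) q :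
  clique_lt e q -> clique_lt (cone e) q.+1.
Proof.
have SI : injective (@Some T) by move=> x y [].
move=> eq Q cQ; rewrite (cardsD1 None).
suff : #|Q :\ None| < q by have := leq_b1 (None \in Q); lia.
have -> : #|Q :\ None| = #|Some @^-1: Q|.
  rewrite -[RHS](card_imset _ SI); apply: eq_card => -[x|].
    by rewrite (mem_imset _ _ SI) !inE.
  by rewrite !inE; apply/esym/imsetP => -[].
apply: eq => x y; rewrite !inE => xQ yQ xy.
by apply: (cQ (Some x) (Some y)) => //; apply: contraNneq xy => -[->].
Qed.

(** The decomposition singles out the entry for the colour of the apex. A clique of that colour in
    the base grows by the apex; one of any other colour already has the right size. *)
Lemma cone_varrows (T : finType) (e : rel T) (f : option T -> nat) b x c :
  simple_graph e ->
  varrows e (b ++ x :: c) -> (forall y, f y < size (b ++ x :: c)) ->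
  f None = size b ->
  exists2 i, i < size (b ++ x.+1 :: c) &
    exists Q : {set option T}, [/\ is_clique (cone e) Q,
      #|Q| = nth 0 (b ++ x.+1 :: c) i & forall y, y \in Q -> f y = i].
Proof.
move=> se ae fa fN.
have [y|i ia [Q [cQ Qa fQ]]] := ae (f \o Some); first exact: fa.
have si : i < size (b ++ x.+1 :: c) by move: ia; rewrite !size_cat.
have cQ' : is_clique (cone e) (Some @: Q) by apply: is_clique_imset cQ.
have [iE|iN] := eqVneq i (size b).
  exists i => //; exists (None |: Some @: Q); split.
  - apply: is_cliqueU1 => //; first by case: (cone_simple se).
    by move=> _ /imsetP[y _ ->].
  - rewrite cardsU1 card_imset ?Qa; last by move=> ? ? [].
    rewrite iE !nth_cat ltnn subnn /=.
    by case: imsetP => [[]|].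
  - by move=> y /setU1P[->|/imsetP[z zQ ->]]; [rewrite fN iE | apply: fQ].
exists i => //; exists (Some @: Q); split => //.
  rewrite card_imset ?Qa; last by move=> ? ? [].
  rewrite !nth_cat; case: ltnP => // bi.
  by have -> : i - size b = (i - size b).-1.+1 by lia.
by move=> _ /imsetP[z zQ ->]; apply: fQ.
Qed.

Lemma cone_inH (T : finType) (e : rel T) m p q :
  inH e m p q -> inH (cone e) m.+1 p q.+1.
Proof.
case=> se [ae ce]; split; [exact: cone_simple|split; last exact: cone_clique_lt].
move=> a a0 am ap f fa.
have := fa None; set i := f None => ia.
have aE : a = take i a ++ nth 0 a i :: drop i.+1 a.
  by rewrite -drop_nth // cat_take_drop.
have si : size (take i a) = i by rewrite size_takel // ltnW.
(* The entry for the colour of the apex cannot be 0; if it is 1 the apex alone suffices; otherwise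
   lowering it by one gives a sequence for [m]. *)
move: aE si; move: (take i a) (drop i.+1 a) (nth 0 a i) => b c [|[|x]] aE si.
- by move: a0; rewrite aE all_cat /= andbF.
- exists i => //; exists [set None]; split; first exact: is_clique1.
    by rewrite cards1 aE nth_cat si ltnn subnn.
  by move=> y /set1P ->.
- rewrite aE; apply: cone_varrows => //; last by move=> y; have := fa y; rewrite aE !size_cat.
  move: a0 am ap; rewrite aE !all_cat !map_cat !sumn_cat /=.
  move=> /andP[b0 c0] am /and3P[bp xp cp]; apply: ae.
  + by rewrite all_cat /= b0.
  + by rewrite map_cat sumn_cat /=; lia.
  + by rewrite all_cat /= bp cp andbT; lia.
Qed.

(** * Hall's theorem and colourings *)

Definition nbrs (T U : finType) (r : T -> U -> bool) (X : {set T}) : {set U} :=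
  [set y | [exists x in X, r x y]].

Lemma nbrsP (T U : finType) (r : T -> U -> bool) (X : {set T}) y :
  reflect (exists2 x, x \in X & r x y) (y \in nbrs r X).
Proof. by rewrite inE; apply: (iffP exists_inP). Qed.

Lemma nbrsU (T U : finType) (r : T -> U -> bool) (X Y : {set T}) :
  nbrs r (X :|: Y) = nbrs r X :|: nbrs r Y.
Proof.
apply/setP => y; rewrite in_setU; apply/nbrsP/orP.
  by case=> x /setUP[] xX rxy; [left | right]; apply/nbrsP; exists x.
by case=> /nbrsP[x xX rxy]; exists x; rewrite // inE xX ?orbT.
Qed.

(** Induction on the size of [A]. If a nonempty proper subset [X] is tight, [X] is matched into its
    neighbours and the rest of [A] outside them. If none is, any [a] may take any neighbour [b],
    since every other set has a neighbour to spare. *)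
Lemma hall (T : finType) (r : rel T) (A B : {set T}) :
  (forall X : {set T}, X \subset A -> #|X| <= #|nbrs r X :&: B|) ->
  exists f : T -> T, {in A &, injective f} /\
                     (forall x, x \in A -> r x (f x) /\ f x \in B).
Proof.
move: {2}#|A| (leqnn #|A|) => n; elim: n A B => [|n IHn] A B An hA.
  move: An; rewrite leqn0 cards_eq0 => /eqP ->.
  by exists id; split=> [x y|x]; rewrite inE.
have [[X [XA X0 XnA Xt]]|notight] := pselect (exists X : {set T},
  [/\ X \subset A, X != set0, X != A & #|nbrs r X :&: B| <= #|X|]).
  have XpA : X \proper A by rewrite properEneq XnA.
  have [||f [fI fX]] := IHn X (nbrs r X :&: B).
  - by have := proper_card XpA; lia.
  - move=> Y YX; have NYX : nbrs r Y \subset nbrs r X.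
      by apply/subsetP => y /nbrsP[x xY rxy]; apply/nbrsP; exists x; rewrite // (subsetP YX).
    by rewrite setIA (setIidPl NYX); apply/hA/(subset_trans YX).
  have [||g [gI gX]] := IHn (A :\: X) (B :\: nbrs r X).
  - rewrite cardsD (setIidPr XA); move: X0; rewrite -cards_eq0.
    have := subset_leq_card XA; lia.
  (* Hall's condition for [X :|: Y] minus the tight count for [X] is the condition for [Y] outside
     the neighbours of [X]. *)
  - move=> Y /subsetDP[YA YX]; have := hA (X :|: Y).
    rewrite subUset XA YA => /(_ isT).
    rewrite cardsU (_ : X :&: Y = set0); last first.
      by apply/disjoint_setI0; rewrite disjoint_sym.
    rewrite cards0 nbrsU.
    have -> : (nbrs r X :|: nbrs r Y) :&: B =
      (nbrs r X :&: B) :|: (nbrs r Y :&: (B :\: nbrs r X)).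
      apply/setP => y; rewrite !(in_setI, in_setU, in_setD).
      by case: (y \in nbrs r X); case: (y \in nbrs r Y); case: (y \in B).
    have := cardsU (nbrs r X :&: B) (nbrs r Y :&: (B :\: nbrs r X)).
    lia.
  exists (fun x => if x \in X then f x else g x); split.
    move=> x y xA yA; case: ifPn => xX; case: ifPn => yX.
    + exact: fI.
    + move=> E; have /gX[_] : y \in A :\: X by rewrite inE yX.
      by rewrite -E inE; have [_] := fX _ xX; rewrite inE => /andP[->].
    + move=> E; have /gX[_] : x \in A :\: X by rewrite inE xX.
      by rewrite E inE; have [_] := fX _ yX; rewrite inE => /andP[->].
    + by apply: gI; rewrite inE ?xX ?yX.
  move=> x xA; case: ifPn => xX.
    by have [rx] := fX _ xX; rewrite inE => /andP[].
  by have [|rx] := gX x; rewrite inE ?xX // => /andP[].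
have [->|/set0Pn[a aA]] := eqVneq A set0.
  by exists id; split=> [x y|x]; rewrite inE.
have /card_gt0P[b] : 0 < #|nbrs r [set a] :&: B|.
  by have := hA [set a]; rewrite sub1set cards1; apply.
rewrite inE => /andP[/nbrsP[_ /set1P -> rab] bB].
have [||f [fI fX]] := IHn (A :\ a) (B :\ b).
- by move: An; rewrite (cardsD1 a) aA.
- move=> X; rewrite subsetD1 => /andP[XA aX].
  have [->|X0] := eqVneq X set0; first by rewrite cards0.
  have XnA : X != A by apply: contraNneq aX => ->.
  have : #|X| < #|nbrs r X :&: B|.
    by rewrite ltnNge; apply/negP => Xt; apply: notight; exists X.
  rewrite (cardsD1 b (_ :&: _)) setIDA; lia.
exists (fun x => if x == a then b else f x); split.
  move=> x y xA yA; case: eqVneq => [->|xa]; case: eqVneq => [->|ya] //.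
  + move=> E; have /fX[_] : y \in A :\ a by rewrite !inE ya.
    by rewrite -E !inE eqxx.
  + move=> E; have /fX[_] : x \in A :\ a by rewrite !inE xa.
    by rewrite E !inE eqxx.
  + by apply: fI; rewrite !inE ?xa ?ya.
move=> x xA; case: eqVneq => [->|xa] //.
by have [|rx] := fX x; rewrite !inE ?xa // => /andP[].
Qed.

(** Induction on the size of [X], with a maximum clique [J] avoiding some [v] in [X]. Exchange
    bounds [X :\: J] by the part of [N X] inside [J]; induction bounds [X :&: J] by [N (X :&: J)],
    which is disjoint from the clique [J]. *)
Lemma nonadjacent_card (T : finType) (e : rel T) q (A X : {set T}) :
  simple_graph e -> clique_lt e q.+1 ->
  (forall v, exists Q : {set T}, [/\ is_clique e Q, #|Q| = q & v \notin Q]) ->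
  is_clique e A -> X \subset A ->
  #|X| <= #|nbrs (fun x y => (x != y) && ~~ e x y) X|.
Proof.
move=> [es ei] eq core cA; pose N := nbrs (fun x y => (x != y) && ~~ e x y).
rewrite -/N; move: {2}#|X| (leqnn #|X|) => n; elim: n X => [|n IHn] X Xn XA.
  by move: Xn; rewrite leqn0 => /eqP ->.
have [->|/set0Pn[v vX]] := eqVneq X set0; first by rewrite cards0.
have [J [cJ Jq vJ]] := core v.
(* exchanging J :&: N X for X in the maximum clique J cannot enlarge it *)
have swap : #|X :\: J| <= #|N X :&: J|.
  have : #|(J :\: N X) :|: X| < q.+1.
    apply: eq => x y /setUP[] xX /setUP[] yX xy.
    - by apply: cJ => //; [move: xX | move: yX]; rewrite inE => /andP[].
    - move: xX; rewrite inE => /andP[xN xJ]; rewrite es.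
      by apply: contraNT xN => exy; apply/nbrsP; exists y; rewrite // eq_sym xy.
    - move: yX; rewrite inE => /andP[yN yJ].
      by apply: contraNT yN => exy; apply/nbrsP; exists x; rewrite // xy.
    - by apply: cA; rewrite // (subsetP XA).
  have -> : (J :\: N X) :|: X = (J :\: N X) :|: (X :\: J).
    apply/setP => x; rewrite !in_setU !in_setD; case: (boolP (x \in J)) => xJ /=; rewrite ?andbT ?andbF ?orbF //.
    apply/orP/idP => [[//|xX]|->]; last by left.
    apply/negP => /nbrsP[y yX /andP[yx /negP[]]].
    by apply: cA; rewrite // (subsetP XA).
  rewrite cardsU (_ : _ :&: _ = set0) ?cards0; last first.
    by apply/setP => x; rewrite !inE; case: (x \in J); rewrite ?andbF.
  have := cardsID (N X) J; rewrite setIC Jq; lia.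
have IH : #|X :&: J| <= #|N (X :&: J)|.
  apply: IHn; last by rewrite subIset ?XA.
  rewrite -ltnS; apply: leq_trans Xn; apply: proper_card.
  by rewrite properE subsetIl /=; apply/subsetPn; exists v; rewrite // inE negb_and vJ orbT.
have sub : (N X :&: J) :|: N (X :&: J) \subset N X.
  rewrite subUset subsetIl; apply/subsetP => y /nbrsP[x /setIP[xX _] rxy].
  by apply/nbrsP; exists x.
have disj : (N X :&: J) :&: N (X :&: J) = set0.
  apply/setP => y; rewrite !in_setI in_set0; apply/negP => /andP[/andP[_ yJ]].
  by case/nbrsP => x /setIP[_ xJ] /andP[xy /negP[]]; apply: cJ.
have := subset_leq_card sub; rewrite cardsU disj cards0.
have := cardsID J X; lia.
Qed.

Lemma coloring_card_sub (T : finType) (e : rel T) q :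
  simple_graph e -> clique_lt e q.+1 -> varrows e [:: 2; q] ->
  exists f : T -> 'I_(#|T| - q), forall x y, f x = f y -> ~~ e x y.
Proof.
move=> [es ei] eq a2q.
(* Colour [v] by 0 and all other vertices by 1: colour 0 has no edge, so a [q]-clique avoids [v]. *)
have core v : exists Q : {set T}, [/\ is_clique e Q, #|Q| = q & v \notin Q].
  have [|i + [Q [cQ Qa fQ]]] := a2q (fun x => x != v).
    by move=> x /=; case: eqP.
  case: i => [|[|//]] in Qa fQ * => _.
    have /cards2P[x [y [xy QE]]] : #|Q| == 2 by rewrite Qa.
    have fx : (x != v) = 0 :> nat by apply: fQ; rewrite QE !inE eqxx.
    have fy : (y != v) = 0 :> nat by apply: fQ; rewrite QE !inE eqxx orbT.
    move: xy; have -> : x = v by apply/eqP; move: fx; case: (x == v).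
    by have -> : y = v; [apply/eqP; move: fy; case: (y == v) | rewrite eqxx].
  exists Q; split=> //; apply/negP => /fQ; by rewrite eqxx.
have [A [cA Aq]] : exists A : {set T}, is_clique e A /\ #|A| = q.
  have [|i + [Q [cQ Qa fQ]]] := a2q (fun x => 1); first by [].
  case: i => [|[|//]] in Qa fQ * => _; last by exists Q.
  have /card_gt0P[x /fQ] : 0 < #|Q| by rewrite Qa.
  by [].
pose r := [rel x y | (x != y) && ~~ e x y].
(* A vertex of the clique [A] has all its non-neighbours outside [A], so the matching goes from [A]
   into its complement. *)
have [X XA|g [gI gA]] := @hall T r A (~: A).
  rewrite (setIidPl _); first exact: (@nonadjacent_card _ e q A).
  apply/subsetP => y /nbrsP[x xX /andP[xy nxy]]; rewrite inE.
  by apply: contra nxy => yA; apply: cA; rewrite // (subsetP XA).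
(* contract each matching edge {x, g x} to g x *)
pose h x := if x \in A then g x else x.
have hA x : h x \in ~: A.
  by rewrite /h; case: ifPn => xA; [case: (gA _ xA) | rewrite inE].
have cC : #|~: A| = #|T| - q by rewrite -Aq -(cardsC A) addKn.
exists (fun x => cast_ord cC (enum_rank_in (hA x) (h x))) => x y.
move/cast_ord_inj/(congr1 enum_val); rewrite !enum_rankK_in //.
rewrite /h; case: ifPn => xA; case: ifPn => yA E.
- by rewrite (gI _ _ xA yA E) ei.
- by rewrite -E; have [/andP[]] := gA _ xA.
- by rewrite E es; have [/andP[]] := gA _ yA.
- by rewrite E ei.
Qed.

Lemma varrows_nseq2 (T : finType) (e : rel T) k (f : T -> 'I_k) :
  (forall x y, f x = f y -> ~~ e x y) -> ~ varrows e (nseq k 2).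
Proof.
move=> fe a2; have [x|i] := a2 f; first by rewrite size_nseq.
rewrite size_nseq => ik [Q [cQ + fQ]]; rewrite nth_nseq ik => Qa.
have /cards2P[x [y [xy QE]]] : #|Q| == 2 by rewrite Qa.
have xQ : x \in Q by rewrite QE !inE eqxx.
have yQ : y \in Q by rewrite QE !inE eqxx orbT.
have /fe/negP[] : f x = f y by apply: val_inj; rewrite /= !fQ.
exact: cQ.
Qed.

(** Arrowing [k] twos means that the chromatic number exceeds [k], whereas [#|T| - q] colours
    suffice. *)
Lemma varrows_nseq2_card (T : finType) (e : rel T) q k :
  simple_graph e -> clique_lt e q.+1 -> varrows e [:: 2; q] ->
  varrows e (nseq k 2) -> q + k < #|T|.
Proof.
move=> se eq a2q a2k; rewrite ltnNge; apply/negP => Tk.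
have [f fe] := coloring_card_sub se eq a2q.
have le : #|T| - q <= k by lia.
apply: (@varrows_nseq2 _ e k (fun x => widen_ord le (f x))) a2k => x y E.
by apply: fe; apply: val_inj; have := congr1 val E.
Qed.

(** * Folkman's theorem *)

Lemma pigeonhole (I : finType) (g : I -> nat) (A : {set I}) (s : seq nat) N :
  (forall i, i \in A -> g i \in s) -> N * size s < #|A| ->
  exists2 c, c \in s & N <= #|[set i in A | g i == c]|.
Proof.
elim: s A => [|c s IHs] A gA sA.
  by have /card_gt0P[i /gA] : 0 < #|A| by lia.
have [cN|Nc] := leqP N #|[set i in A | g i == c]|.
  by exists c => //; rewrite inE eqxx.
have AE := cardsID [set i | g i == c] A.
have cE : [set i in A | g i == c] = A :&: [set i | g i == c].
  by apply/setP => i; rewrite !inE.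
have [i||d ds dN] := IHs (A :\: [set i | g i == c]).
- rewrite !inE => /andP[gc /gA]; by rewrite inE (negPf gc).
- by move: sA Nc; rewrite cE /=; lia.
exists d; first by rewrite inE ds orbT.
apply: leq_trans dN _; apply: subset_leq_card; apply/subsetP => i.
by rewrite !inE => /andP[/andP[_ ->]].
Qed.

(** The palette is any list of at most [r] colours, so that a colour can be removed from it without
    renaming the others. *)
Definition mono_arrows (T : finType) (e : rel T) (r p : nat) : Prop :=
  forall (f : T -> nat) (s : seq nat), size s <= r -> (forall x, f x \in s) ->
    exists c, exists Q : {set T},
      [/\ is_clique e Q, #|Q| = p & forall x, x \in Q -> f x = c].

Section FolkmanStep.

Variables (S H : finType) (eS : rel S) (eH : rel H) (n : nat).

(* Each vertex h of the copy of H indexed by k is joined to the vertices of the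
   set (k h).2 in the copy of S number (k h).1. *)
Definition folkman_vertex : finType :=
  (('I_n * S) + ({ffun H -> 'I_n * {set S}} * H))%type.

(** Injectivity sends distinct vertices of one copy of [H] to distinct copies of [S], so they have
    no common neighbour there. *)
Definition attached (u : 'I_n * S) (v : {ffun H -> 'I_n * {set S}} * H) : bool :=
  [&& injectiveb (fun h => (v.1 h).1), (v.1 v.2).1 == u.1 & u.2 \in (v.1 v.2).2].

Definition folkman_graph : rel folkman_vertex := fun u v =>
  match u, v with
  | inl u, inl v => (u.1 == v.1) && eS u.2 v.2
  | inr u, inr v => (u.1 == v.1) && eH u.2 v.2
  | inl u, inr v => attached u v
  | inr u, inl v => attached v u
  end.

Lemma folkman_simple :
  simple_graph eS -> simple_graph eH -> simple_graph folkman_graph.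
Proof.
move=> [sS iS] [sH iH]; split=> [[u|u] [v|v]|[u|u]] //=.
- by rewrite eq_sym sS.
- by rewrite eq_sym sH.
- by rewrite iS andbF.
- by rewrite iH andbF.
Qed.

Definition is_copyH (w : folkman_vertex) : bool :=
  if w is inr _ then true else false.

Lemma folkman_cliqueS p (Q : {set folkman_vertex}) :
  clique_lt eS p.+1 -> is_clique folkman_graph Q ->
  (forall w, w \in Q -> ~~ is_copyH w) -> #|Q| <= p.
Proof.
move=> cS cQ QS; have [->|/set0Pn[[[i x]|w] wQ]] := eqVneq Q set0; first by rewrite cards0.
  pose X := [set y | inl (i, y) \in Q] : {set S}.
  have QX : Q \subset (fun y => inl (i, y)) @: X.
    apply/subsetP => -[[j y]|u] uQ; last by have := QS _ uQ.
    have ji : j = i.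
      apply/eqP; apply: contraT => ji; have := cQ _ _ uQ wQ.
      rewrite /= (negPf ji) => H0; apply: H0; apply: contraNneq ji => -[-> _] //.
    by rewrite ji in uQ *; apply/imsetP; exists y; rewrite ?inE.
  apply: (leq_trans (subset_leq_card QX)); apply: (leq_trans (leq_imset_card _ _)).
  rewrite -ltnS; apply: cS => y z; rewrite !inE => yQ zQ yz.
  have := cQ _ _ yQ zQ; rewrite /= eqxx; apply; apply: contraNneq yz => -[->] //.
by have := QS _ wQ.
Qed.

(** A clique with two vertices in copies of [H] lies within a single copy of [H]. Any other clique
    is a clique of one copy of [S] plus at most one vertex. *)
Lemma folkman_clique_lt p :
  clique_lt eS p.+1 -> clique_lt eH p.+2 -> clique_lt folkman_graph p.+2.
Proof.
move=> cS cH Q cQ.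
have [[[k h] wQ]|noH] := pselect (exists w, inr w \in Q); last first.
  rewrite ltnS leqW //; apply: folkman_cliqueS cS cQ _ => -[//|w] wQ.
  by case: noH; exists w.
have [[[k' h'] w'Q w'w]|oneH] :=
    pselect (exists2 w, inr w \in Q & w != (k, h)); last first.
  rewrite (cardsD1 (inr (k, h))) wQ add1n !ltnS.
  apply: folkman_cliqueS cS _ _; first exact/is_cliqueS/cQ/subD1set.
  move=> [//|w] /setD1P[wN wQ']; case: oneH; by exists w.
have copy u : inr u \in Q -> u.1 = k.
  move=> uQ; have [->//|uw] := eqVneq u (k, h).
  apply/eqP; suff /andP[] : folkman_graph (inr u) (inr (k, h)) by [].
  by apply: cQ => //; apply: contraNneq uw => -[->].
have kk' : k' = k := copy _ w'Q; rewrite {}kk' in w'Q w'w.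
have noS u : inl u \notin Q.
  apply/negP => uQ.
  have /and3P[/injectiveP kI /= /eqP uh _] : folkman_graph (inl u) (inr (k, h)).
    exact: cQ.
  have /and3P[_ /= /eqP uh' _] : folkman_graph (inl u) (inr (k, h')).
    exact: cQ.
  by case/eqP: w'w; congr (_, _); apply: kI; rewrite uh uh'.
pose X := [set x | inr (k, x) \in Q] : {set H}.
have QX : Q \subset (fun x => inr (k, x)) @: X.
  apply/subsetP => -[u|[k1 x]] uQ; first by have := noS u; rewrite uQ.
  have /= kE := copy _ uQ; rewrite kE in uQ *.
  by apply/imsetP; exists x; rewrite ?inE.
apply: (leq_ltn_trans (subset_leq_card QX)).
apply: (leq_ltn_trans (leq_imset_card _ _)).
apply: cH => y z; rewrite !inE => yQ zQ yz.
have /andP[_ //] : folkman_graph (inr (k, y)) (inr (k, z)).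
by apply: cQ => //; apply: contraNneq yz => -[->].
Qed.

(** Every copy of [S] contains a monochromatic clique of size [p.+1], and at least [#|H|] of these
    share a colour [c]. In the copy of [H] attached to them, a vertex of colour [c] enlarges one of
    the cliques; if there is none, only [r] colours remain on that copy. *)
Lemma folkman_arrows p r :
  simple_graph eS -> simple_graph eH -> #|H| * r.+1 < n ->
  mono_arrows eS r.+1 p.+1 -> mono_arrows eH r p.+2 ->
  mono_arrows folkman_graph r.+1 p.+2.
Proof.
move=> gS gH Hn aS aH f s sr fs.
have [fs1 fs2] := folkman_simple gS gH.
have /choice[g gP] : forall i : 'I_n, exists cQ : nat * {set S},
    [/\ is_clique eS cQ.2, #|cQ.2| = p.+1 &
        forall x, x \in cQ.2 -> f (inl (i, x)) = cQ.1].
  move=> i; have [c [Q cQ]] := aS (fun x => f (inl (i, x))) s sr (fun x => fs _).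
  by exists (c, Q).
have [i _||c cs cN] := @pigeonhole _ (fun i => (g i).1) [set: 'I_n] s #|H|.
- have [_ Qp fQ] := gP i; have /card_gt0P[x xQ] : 0 < #|(g i).2| by rewrite Qp.
  by rewrite -(fQ x).
- rewrite cardsT card_ord; apply: leq_ltn_trans Hn; by rewrite leq_mul2l sr orbT.
set A := [set i in _ | _] in cN.
pose phi h : 'I_n := enum_val (widen_ord cN (enum_rank h)).
have phiI : injective phi.
  move=> x y /enum_val_inj E; apply: enum_rank_inj; apply: val_inj.
  exact: (congr1 val E).
have phiA h : (g (phi h)).1 = c.
  by have := enum_valP (widen_ord cN (enum_rank h)); rewrite !inE => /andP[_ /eqP].
(* This index attaches each [h] exactly to the chosen clique of colour [c] in copy [phi h] of
   [S]. *)
pose k : {ffun H -> 'I_n * {set S}} := [ffun h => (phi h, (g (phi h)).2)].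
have kI : injectiveb (fun h => (k h).1).
  by apply/injectiveP => x y; rewrite !ffunE; apply: phiI.
have [[h fh]|noc] := pselect (exists h, f (inr (k, h)) = c).
  have [cQ Qp fQ] := gP (phi h).
  exists c, (inr (k, h) |: (fun x => inl (phi h, x)) @: (g (phi h)).2); split.
  - apply: is_cliqueU1 => //.
      by apply: is_clique_imset cQ => x y /=; rewrite eqxx.
    by move=> _ /imsetP[x xQ ->]; rewrite /= /attached kI /= !ffunE /= eqxx.
  - rewrite cardsU1 card_imset ?Qp; last by move=> x y [].
    by case: imsetP => [[]|].
  - move=> _ /setU1P[->//|/imsetP[x xQ ->]]; by rewrite fQ.
have [||d [Q [cQ Qp fQ]]] := aH (fun h => f (inr (k, h))) (rem c s).
- by rewrite size_rem // -ltnS; case: (size s) sr.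
- move=> h; have := fs (inr (k, h)); rewrite (perm_mem (perm_to_rem cs)) inE.
  by case: eqP => // E; case: noc; exists h.
exists d, ((fun x => inr (k, x)) @: Q); split.
- by apply: is_clique_imset cQ => x y /=; rewrite eqxx.
- by rewrite card_imset // => x y [].
- by move=> _ /imsetP[x xQ ->]; apply: fQ.
Qed.

End FolkmanStep.

Lemma folkman p r : exists (T : finType) (e : rel T),
  [/\ simple_graph e, clique_lt e p.+2 & mono_arrows e r p.+1].
Proof.
pose e0 : rel unit := fun _ _ => false.
have e0s : simple_graph e0 by [].
have e0c q : clique_lt e0 q.+2.
  move=> Q _; rewrite ltnS; apply: leq_trans (max_card _) _; by rewrite card_unit.
elim: p r => [|p IHp] r.
  exists unit, e0; split=> // f s _ _; exists (f tt), [set tt]; split.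
  - exact: is_clique1.
  - by rewrite cards1.
  - by case.
elim: r => [|r [H [eH [gH cH aH]]]].
  (* An empty palette cannot colour the single vertex. *)
  exists unit, e0; split=> // f s; rewrite leqn0 size_eq0 => /eqP -> /(_ tt).
  by [].
have [S [eS [gS cS aS]]] := IHp r.+1.
exists (folkman_vertex S H (#|H| * r.+1).+1), (@folkman_graph _ _ eS eH _); split.
- exact: folkman_simple.
- exact: folkman_clique_lt.
- exact: folkman_arrows.
Qed.

(** Any vertex whose colour has entry 1 is already a suitable clique. Otherwise only colours with
    entry at least 2 occur, at most [p + 1] of them by the sum condition, and a monochromatic
    [p]-clique contains one of the required size. *)
Lemma inH_exists p : 0 < p ->
  exists (T : finType) (e : rel T), inH e (p + 2) p (p + 1).
Proof.
case: p => // p _; have [T [e [se ce ae]]] := folkman p p.+2.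
exists T, e; split=> //; split; last by rewrite addn1.
move=> a a0 am ap f fa.
have [[x fx]|no1] := pselect (exists x, nth 0 a (f x) = 1).
  exists (f x); first exact: fa.
  exists [set x]; split; [exact: is_clique1 | by rewrite cards1 fx|].
  by move=> y /set1P ->.
pose s := [seq i <- iota 0 (size a) | 1 < nth 0 a i].
have fs x : f x \in s.
  rewrite mem_filter mem_iota /= add0n fa andbT.
  have /(allP a0) : nth 0 a (f x) \in a by rewrite mem_nth.
  rewrite leq_eqVlt => /predU1P[E|//]; by case: no1; exists x.
have sp : size s <= p.+2.
  have -> : size s = count (fun x => 1 < x) a.
    rewrite size_filter -[in RHS](mkseq_nth 0 a) count_map.
    exact: eq_count.
  suff : count (fun x => 1 < x) a <= sumn (map predn a) by lia.
  by elim: (a) => //= x b IHb; lia.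
have [c [Q [cQ Qp fQ]]] := ae f s sp fs.
have /card_gt0P[x xQ] : 0 < #|Q| by rewrite Qp.
have ca : c < size a by rewrite -(fQ x).
exists c => //; have /(allP ap) : nth 0 a c \in a by rewrite mem_nth.
rewrite -Qp => /subset_of_card[P PQ Pc].
exists P; split=> //; first exact: is_cliqueS PQ cQ.
by move=> y /(subsetP PQ)/fQ.
Qed.

(** * The numbers F~_v(m|_p; m-1) *)

(** Putting a 2 in front of the sequence raises the sum by one and respects the bound [p]; that
    extra colour is spent on the deleted independent set. *)
Lemma relpre_inH (S T : finType) (e : rel T) (f : S -> T) m p q q' :
  injective f ->
  (forall x y, x \notin codom f -> y \notin codom f -> ~~ e x y) ->
  1 < p -> inH e m.+1 p q -> clique_lt (relpre f e) q' ->
  inH (relpre f e) m p q'.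
Proof.
move=> fI ind p1 [se [ae _]] ce; split; [exact: relpre_simple | split=> //].
move=> a a0 am ap; apply: relpre_varrows_behead => //; apply: ae => /=.
- by [].
- by lia.
- by rewrite p1.
Qed.

Lemma codom_val_setC (T : finType) (A : {set T}) x :
  (x \in codom (val : {y | y \in ~: A} -> T)) = (x \notin A).
Proof.
apply/codomP/idP => [[[y yA] ->]|xA]; first by rewrite -in_setC.
have xC : x \in ~: A by rewrite in_setC.
by exists (exist _ x xC).
Qed.

Lemma card_setC_sig (T : finType) (A : {set T}) :
  #|{: {y | y \in ~: A}}| = #|T| - #|A|.
Proof. by rewrite card_sig -(cardsC A) addKn; apply: eq_card. Qed.

Lemma inH_nseq2 (T : finType) (e : rel T) m p q :
  1 < p -> 0 < m -> inH e m p q -> varrows e (nseq m.-1 2).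
Proof.
move=> p1 m0 [_ [ae _]]; apply: ae; rewrite ?all_nseq ?p1 ?orbT //.
by rewrite map_nseq sumn_nseq /=; lia.
Qed.

Lemma inH_card_gt0 (T : finType) (e : rel T) m p q :
  1 < p -> 1 < m -> inH e m p q -> 0 < #|T|.
Proof.
move=> p1 m1 eH; have [T0|//] := posnP #|T|.
have noT (x : T) : False by have := max_card (pred1 x); rewrite T0 card1.
have [x|i] := @inH_nseq2 _ _ _ _ _ p1 (ltnW m1) eH (fun=> 0); first by case: (noT x).
rewrite size_nseq => im [Q [_ + _]]; rewrite nth_nseq im => Q2.
by have := max_card (mem Q); rewrite T0 Q2.
Qed.

(** In a colouring without the required cliques, colour 0 is independent and colour 1 contains no
    [q]-clique. *)
Lemma not_varrows2_delete (T : finType) (e : rel T) q :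
  simple_graph e -> 0 < #|T| -> ~ varrows e [:: 2; q] ->
  exists I : {set T}, [/\ I != set0, forall x y, x \in I -> y \in I -> ~~ e x y &
    clique_lt (relpre (val : {y | y \in ~: I} -> T) e) q].
Proof.
move=> [es ei] /card_gt0P[v _] /existsNP[f] /not_implyP[f2 nf].
pose V1 := [set x | f x == 0].
have [I [I0 V1I ind]] : exists I : {set T}, [/\ I != set0, V1 \subset I &
    forall x y, x \in I -> y \in I -> ~~ e x y].
  (* An empty class is replaced by a single vertex, so that the deletion really lowers the order. *)
  have [V0|V0] := eqVneq V1 set0.
    exists [set v]; split; first by apply/set0Pn; exists v; rewrite inE.
      by rewrite V0 sub0set.
    by move=> x y /set1P -> /set1P ->; rewrite ei.
  exists V1; split=> // x y; rewrite !inE => /eqP fx /eqP fy; apply/negP => exy.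
  apply: nf; exists 0 => //; exists [set x; y]; split.
  - by apply: is_cliqueU1 => //; [exact: is_clique1 | move=> z /set1P ->].
  - rewrite cards2; case: eqP exy => // ->; by rewrite ei.
  - by move=> z; rewrite !inE => /orP[] /eqP ->.
exists I; split=> // Q cQ; rewrite ltnNge; apply/negP.
move=> /subset_of_card[P PQ Pq]; apply: nf; exists 1 => //.
exists (val @: P); split.
- by apply: is_clique_imset (is_cliqueS PQ cQ).
- by rewrite card_imset //; apply: val_inj.
- move=> _ /imsetP[[x xI] _ ->] /=; move: xI; rewrite in_setC => xI.
  have : x \notin V1 by apply: contra xI; apply/subsetP.
  by rewrite inE; have := f2 x; case: (f x) => [|[]].
Qed.

Lemma Fv_cone (T : finType) (e : rel T) m p : 0 < m ->
  inH e m p m.-1 -> Fv m.+1 p m <= (Fv m p m.-1).+1.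
Proof.
move=> m0 /Fv_witness[e' /cone_inH]; rewrite prednK // => /Fv_le.
by rewrite card_option card_ord.
Qed.

(** Iterated cones over the Folkman graph for [p + 2]. *)
Lemma inH_exists_all p m : 0 < p -> p + 2 <= m ->
  exists (T : finType) (e : rel T), inH e m p m.-1.
Proof.
move=> p0 /subnK <-; elim: (m - _) => [|k [T [e He]]].
  by have := inH_exists p0; rewrite add0n addn2 addn1.
exists (option T), (cone e); rewrite addSn.
by have := cone_inH He; rewrite prednK // addn2 addnS.
Qed.

(** Entries at most 1 make the sum 0 and force [m = 1]; for larger [m] even the empty graph
    qualifies. *)
Lemma Fv_one m : 2 < m -> Fv m 1 m.-1 = 0.
Proof.
move=> m2; apply/eqP; rewrite -leqn0 -[X in _ <= X]card_void.
apply: (@Fv_le _ (fun _ _ => false)); split; first by split=> [[]|[]].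
split=> [a a0 am a1|Q _]; last by rewrite (leq_ltn_trans (max_card _)) ?card_void; lia.
suff : sumn (map predn a) = 0 by lia.
by elim: (a) a1 => //= -[|[|x]] b IHb.
Qed.

Theorem theorem2p1 (p m0 : nat) :
  0 < p ->
  (* m0 is the smallest m >= p+2 at which F~_v(m|_p; m-1) - m attains its minimum *)
  p + 2 <= m0 ->
  (forall m, p + 2 <= m -> Fv m0 p m0.-1 + m <= Fv m p m.-1 + m0) ->
  (forall m, p + 2 <= m -> m < m0 -> Fv m0 p m0.-1 + m < Fv m p m.-1 + m0) ->
  [/\ (* (a) *)
      (forall m, m0 <= m -> Fv m p m.-1 = Fv m0 p m0.-1 + m - m0),
      (* (b) *)
      (p + 2 < m0 ->
       forall (T : finType) (e : rel T),
         inH e m0 p m0.-1 -> #|T| = Fv m0 p m0.-1 ->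
         varrows e [:: 2; m0 - 2]) &
      (* (c) *)
      m0 + p < Fv (p + 2) p (p + 1)].
Proof.
move=> p0 pm hmin hfirst.
have p1 : 1 < p.
  case: p p0 pm hmin {hfirst} => [|[|p]] // _ pm hmin.
  have := hmin m0.+1; rewrite !Fv_one; lia.
have b : p + 2 < m0 -> forall (T : finType) (e : rel T),
    inH e m0 p m0.-1 -> #|T| = Fv m0 p m0.-1 -> varrows e [:: 2; m0 - 2].
  move=> pm' T e He eT; apply: contrapT => nv.
  have [se _] := He; have T0 : 0 < #|T| by apply: inH_card_gt0 He => //; lia.
  have [I [I0 ind ce]] := not_varrows2_delete se T0 nv.
  have He' : inH e m0.-1.+1 p m0.-1 by rewrite prednK //; lia.
  have : inH (relpre (val : {y | y \in ~: I} -> T) e) m0.-1 p (m0 - 2).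
    apply: relpre_inH He' ce => //; first exact: val_inj.
    by move=> x y; rewrite !codom_val_setC !negbK; apply: ind.
  move/Fv_le; rewrite card_setC_sig eT.
  (* As [m0 - 1] is at least [p + 2] and precedes the first minimiser, F(m0 - 1) >= F(m0), but the
     deletion left fewer vertices. *)
  have := hfirst m0.-1; rewrite -subn2.
  move: I0; rewrite -card_gt0; have := max_card (mem I); lia.
split=> //.
  (* Minimality at [m0] gives the lower bound, repeated coning from [m0] the upper one. *)
  move=> m mm0; apply/eqP; rewrite eqn_leq; apply/andP; split; last first.
    have := hmin m; lia.
  rewrite -(subnK mm0); elim: (m - m0) => [|k IHk]; first by rewrite add0n addnK.
  have [|T [e He]] := @inH_exists_all p (k + m0) p0; first by lia.
  have := Fv_cone _ He; rewrite addSn /=; lia.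
have [T [e He]] := @inH_exists_all p m0 p0 pm.
have [e0 He0] := Fv_witness He.
have [se [ae ce]] := He0.
have [m0E|m0N] := eqVneq m0 (p + 2); last first.
  (* This yields F(m0) >= 2 m0 - 2; strict minimality against [p + 2] turns it into the claim. *)
  have := @varrows_nseq2_card _ e0 (m0 - 2) m0.-1 se.
  have -> : (m0 - 2).+1 = m0.-1 by lia.
  move=> /(_ ce); have pm' : p + 2 < m0 by lia.
  move=> /(_ (b pm' _ _ He0 (card_ord _))).
  move=> /(_ (inH_nseq2 p1 _ He0)); rewrite card_ord.
  have := hfirst (p + 2); rewrite addn1 addn2 /=; lia.
have -> : p + 1 = m0.-1 by lia.
rewrite -m0E.
(* A complete graph here would have fewer than [m0 - 1] vertices, and giving each its own colour
   would contradict the arrowing of [m0 - 1] twos. *)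
have [x [y [xy nexy]]] : exists x y, x != y /\ ~~ e0 x y.
  apply: contrapT => nc.
  have : #|[set: 'I_(Fv m0 p m0.-1)]| < m0.-1.
    apply: ce => x y _ _ xy; apply: contrapT => /negP nexy; apply: nc.
    by exists x, y.
  rewrite cardsT card_ord => /ltnW le.
  have m0_gt0 : 0 < m0 by lia.
  apply: (@varrows_nseq2 _ e0 _ (widen_ord le)) (inH_nseq2 p1 m0_gt0 He0).
  by move=> x y /(congr1 val) /= /val_inj ->; case: se => _ ->.
pose v := val : {z | z \in ~: [set x; y]} -> 'I_(Fv m0 p m0.-1).
have behead a : varrows e0 (2 :: a) -> varrows (relpre v e0) a.
  apply: relpre_varrows_behead; first exact: val_inj.
  case: se => es ei z t; rewrite !codom_val_setC !negbK !inE.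
  by move=> /orP[] /eqP -> /orP[] /eqP ->; rewrite ?ei // es.
(* The removed pair uses up one 2, taken from (2, 2, p) and from the [p + 1] twos. The bound F(m0) -
   2 > 2p is one better than the same argument gives without the removal. *)
have : p + p < #|{: {z | z \in ~: [set x; y]}}|.
  apply: (@varrows_nseq2_card _ (relpre v e0)).
  - exact: relpre_simple.
  - apply: relpre_clique_lt; first exact: val_inj.
    by have -> : p.+1 = m0.-1 by lia.
  - apply/behead/ae => /=; rewrite ?p0 ?p1 ?leqnn //; lia.
  - apply: behead; have -> : 2 :: nseq p 2 = nseq m0.-1 2 by rewrite m0E addn2.
    by apply: inH_nseq2 He0 => //; lia.
rewrite card_setC_sig cards2 xy card_ord; lia.
Qed.
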